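(* Let $x\in\mathbf{R}^n$, $y\in\mathbf{R}^m$, $Z\in\mathbf{S}^d$, $\sigma>0$, $H\in\mathbf{R}^{n\times n}$, and put $M:=H+\frac1\sigma\nabla g(x)\nabla g(x)^\top$, $s:=y-\frac1\sigma g(x)$, $T:=Z-\frac1\sigma X(x)$. Suppose that $M\succ O$. Then the problem $$\min_{(\xi,\Sigma)\in\mathbf{R}^n\times\mathbf{S}^d}\ \langle\nabla f(x)-\nabla g(x)s,\xi\rangle+\tfrac12\langle M\xi,\xi\rangle+\tfrac\sigma2\|\Sigma\|_{\rm F}^2\quad\text{subject to}\quad\mathcal{A}(x)\xi+\sigma(\Sigma-T)\succeq O$$ has a unique optimal solution.
   Context: $\mathbf{S}^d$ is the space of real symmetric $d\times d$ matrices; $\succeq O$, $\succ O$ mean (symmetric) positive semidefinite, positive definite; $\langle A,B\rangle={\rm tr}(A^\top B)$; $\|\cdot\|_{\rm F}$ is the Frobenius norm. $f:\mathbf{R}^n\to\mathbf{R}$, $g=(g_1,\dots,g_m):\mathbf{R}^n\to\mathbf{R}^m$, $X:\mathbf{R}^n\to\mathbf{S}^d$ are twice continuously differentiable. $\nabla g(x)=[\nabla g_1(x)\cdots\nabla g_m(x)]\in\mathbf{R}^{n\times m}$; $\mathcal{A}(x)u=\sum_{i=1}^nu_iA_i(x)$ for $u\in\mathbf{R}^n$, where $A_i(x)=\partial X(x)/\partial x_i\in\mathbf{S}^d$. *)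

(* Defs.v *)
From HB Require Import structures.
From mathcomp Require Import all_boot all_order all_algebra.
From mathcomp Require Import all_classical all_reals all_analysis.

Set Implicit Arguments.
Unset Strict Implicit.
Unset Printing Implicit Defensive.
Import Order.TTheory GRing.Theory Num.Theory.
Import numFieldNormedType.Exports.
Local Open Scope classical_set_scope.
Local Open Scope ring_scope.

Section Matrices.
Variable R : realType.

(* For columns u, v this is the usual inner product of R^n, as u^T *m v is
   a 1 x 1 matrix. *)
Definition mxdot p q (A B : 'M[R]_(p, q)) : R := \tr (A^T *m B).

(* Not the library norm `|A|, which is the max-norm of the entries. *)
Definition frob p q (A : 'M[R]_(p, q)) : R := Num.sqrt (mxdot A A).

Definition posdefmx p (A : 'M[R]_p) : Prop :=
  A \is symmetricmx /\ forall v : 'cV[R]_p, v != 0 -> 0 < mxdot (A *m v) v.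

Definition possemidefmx p (A : 'M[R]_p) : Prop :=
  A \is symmetricmx /\ forall v : 'cV[R]_p, 0 <= mxdot (A *m v) v.

End Matrices.

Section Calculus.
Variables (R : realType) (n : nat).

Definition partial (W : normedModType R) (i : 'I_n) (F : 'cV[R]_n -> W) :
  'cV[R]_n -> W := 'D_(delta_mx i 0) F.

Definition C1 (W : normedModType R) (F : 'cV[R]_n -> W) : Prop :=
  (forall z, differentiable F z) /\ forall i, continuous (partial i F).

Definition C2 (W : normedModType R) (F : 'cV[R]_n -> W) : Prop :=
  C1 F /\ forall i, C1 (partial i F).

Definition grad (f : 'cV[R]_n -> R) (x : 'cV[R]_n) : 'cV[R]_n :=
  \col_i partial i f x.

(* The gradients of the components are the columns: this is the transpose of
   the usual Jacobian matrix. *)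
Definition grads m (g : 'cV[R]_n -> 'cV[R]_m) (x : 'cV[R]_n) : 'M[R]_(n, m) :=
  \matrix_(i, j) grad (fun z => g z j 0) x i 0.

Definition opA d (X : 'cV[R]_n -> 'M[R]_d) (x u : 'cV[R]_n) : 'M[R]_d :=
  \sum_i u i 0 *: partial i X x.

End Calculus.

Definition optimal_solution (R : realType) (P : Type) (feasible : set P)
    (objective : P -> R) (p : P) : Prop :=
  feasible p /\ forall p', feasible p' -> objective p <= objective p'.

(* Main.v *)
(* The pair (0, T) is feasible, since T is symmetric and the constraint
   matrix vanishes there.  Positive definiteness of M bounds <M xi, xi> below
   by e |xi|^2 (minimum over the unit sphere), so completing the square in the
   linear term shows that sublevel sets of the objective are bounded; as the
   feasible set is closed, a minimizer exists by compactness.  Two distinct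
   minimizers would have a feasible midpoint with strictly smaller value, by
   the parallelogram identity. *)
Require Import Defs.
From HB Require Import structures.
From mathcomp Require Import all_boot all_order all_algebra.
From mathcomp Require Import all_classical all_reals all_analysis.
From mathcomp Require Import ring lra.

Set Implicit Arguments.
Unset Strict Implicit.
Unset Printing Implicit Defensive.
Import Order.TTheory GRing.Theory Num.Theory.
Import numFieldNormedType.Exports.
Local Open Scope classical_set_scope.
Local Open Scope ring_scope.

(** * Algebra of the trace inner product and of symmetric and semidefinite matrices *)

Section MatrixInnerProduct.
Variable R : realType.

Lemma mxdotE p q (A B : 'M[R]_(p, q)) :
  mxdot A B = \sum_i \sum_j A i j * B i j.
Proof.
rewrite /mxdot /mxtrace exchange_big /=.
by apply: eq_bigr => j _; rewrite mxE; apply: eq_bigr => i _; rewrite mxE.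
Qed.

Lemma mxdotC p q (A B : 'M[R]_(p, q)) : mxdot A B = mxdot B A.
Proof. by rewrite /mxdot -mxtrace_tr trmx_mul trmxK. Qed.

Lemma mxdotDr p q (A B C : 'M[R]_(p, q)) :
  mxdot A (B + C) = mxdot A B + mxdot A C.
Proof. by rewrite /mxdot mulmxDr mxtraceD. Qed.

Lemma mxdotZr p q k (A B : 'M[R]_(p, q)) : mxdot A (k *: B) = k * mxdot A B.
Proof. by rewrite /mxdot -scalemxAr mxtraceZ. Qed.

Lemma mxdotDl p q (A B C : 'M[R]_(p, q)) :
  mxdot (A + B) C = mxdot A C + mxdot B C.
Proof. by rewrite mxdotC mxdotDr !(mxdotC C). Qed.

Lemma mxdotZl p q k (A B : 'M[R]_(p, q)) : mxdot (k *: A) B = k * mxdot A B.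
Proof. by rewrite mxdotC mxdotZr mxdotC. Qed.

Lemma mxdot0 p q (A : 'M[R]_(p, q)) : mxdot A 0 = 0.
Proof. by rewrite -(scale0r (0 : 'M[R]_(p, q))) mxdotZr mul0r. Qed.

(** This entrywise control yields both definiteness of the inner product and, later, the box that
    encloses a ball. *)
Lemma sqr_coord_le_mxdot p q (A : 'M[R]_(p, q)) i j : A i j ^+ 2 <= mxdot A A.
Proof.
rewrite mxdotE (bigD1 i) //= (bigD1 j) //= -expr2 -addrA lerDl.
apply: addr_ge0; apply: sumr_ge0 => k _; first by rewrite -expr2 sqr_ge0.
by apply: sumr_ge0 => l _; rewrite -expr2 sqr_ge0.
Qed.

Lemma mxdot_ge0 p q (A : 'M[R]_(p, q)) : 0 <= mxdot A A.
Proof.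
by rewrite mxdotE; apply: sumr_ge0 => i _; apply: sumr_ge0 => j _;
  rewrite -expr2 sqr_ge0.
Qed.

Lemma mxdot_le0 p q (A : 'M[R]_(p, q)) : mxdot A A <= 0 -> A = 0.
Proof.
move=> A_le0; apply/matrixP => i j; rewrite mxE; apply/eqP.
rewrite -sqrf_eq0 eq_le sqr_ge0 andbT.
exact: le_trans (sqr_coord_le_mxdot A i j) A_le0.
Qed.

Lemma frob_sqr p q (A : 'M[R]_(p, q)) : frob A ^+ 2 = mxdot A A.
Proof. by rewrite sqr_sqrtr // mxdot_ge0. Qed.

(** Expand the square of [A + (k / 2) *: B], which is nonnegative, and divide by [k]. The factor
    [k / 4] is chosen so that half of a form with coercivity constant [k] absorbs the [B] term and
    still leaves [k / 4]. *)
Lemma mxdot_AMGM p q (k : R) (A B : 'M[R]_(p, q)) : 0 < k ->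
  - (k^-1 * mxdot A A) - k / 4 * mxdot B B <= mxdot A B.
Proof.
move=> k_gt0; have := mxdot_ge0 (A + (k / 2) *: B).
rewrite !(mxdotDl, mxdotDr, mxdotZl, mxdotZr) (mxdotC B A).
set a := mxdot A A; set b := mxdot B B; set c := mxdot A B => sq_ge0.
rewrite -subr_ge0.
have -> : c - (- (k^-1 * a) - k / 4 * b) =
    k^-1 * (a + k / 2 * c + k / 2 * (c + k / 2 * b)).
  by field; rewrite gt_eqF.
by apply: mulr_ge0; [rewrite invr_ge0 ltW|lra].
Qed.

(** Parallelogram identity for the form of [M]: the mixed terms carry the factor 1/4 on both sides,
    so they match without being merged. *)
Lemma mxdot_midpoint p q (M : 'M[R]_p) (A B : 'M[R]_(p, q)) :
  mxdot (M *m (2^-1 *: (A + B))) (2^-1 *: (A + B)) =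
  2^-1 * (mxdot (M *m A) A + mxdot (M *m B) B)
    - 4^-1 * mxdot (M *m (A - B)) (A - B).
Proof.
rewrite -scalemxAr -(scaleN1r B) !mulmxDr -scalemxAr.
by rewrite !(mxdotDl, mxdotDr, mxdotZl, mxdotZr); field.
Qed.

(** [symmetricmx] is the hermitian predicate with trivial sign and identity automorphism; both have
    to be removed to reach plain transposition. *)
Lemma symmetricmxP p (A : 'M[R]_p) : reflect (A^T = A) (A \is symmetricmx).
Proof.
have -> : A^T = (-1) ^+ false *: map_mx idfun A^T.
  by rewrite expr0 scale1r map_mx_id.
by apply: (iffP (is_hermitianmxP _ _ _)) => /esym.
Qed.

Lemma symmetricmxD p (A B : 'M[R]_p) :
  A \is symmetricmx -> B \is symmetricmx -> A + B \is symmetricmx.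
Proof.
by move=> /symmetricmxP A_sym /symmetricmxP B_sym;
  apply/symmetricmxP; rewrite linearD /= A_sym B_sym.
Qed.

Lemma symmetricmxZ p k (A : 'M[R]_p) :
  A \is symmetricmx -> k *: A \is symmetricmx.
Proof.
by move=> /symmetricmxP A_sym; apply/symmetricmxP; rewrite linearZ /= A_sym.
Qed.

Lemma possemidefmx0 p : possemidefmx (0 : 'M[R]_p).
Proof.
by split=> [|v]; [apply/symmetricmxP; rewrite trmx0
                 |rewrite mul0mx mxdotC mxdot0].
Qed.

Lemma possemidefmxD p (A B : 'M[R]_p) :
  possemidefmx A -> possemidefmx B -> possemidefmx (A + B).
Proof.
move=> [A_sym A_ge0] [B_sym B_ge0]; split=> [|v]; first exact: symmetricmxD.
by rewrite mulmxDl mxdotDl addr_ge0.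
Qed.

Lemma possemidefmxZ p k (A : 'M[R]_p) :
  0 <= k -> possemidefmx A -> possemidefmx (k *: A).
Proof.
move=> k_ge0 [A_sym A_ge0]; split=> [|v]; first exact: symmetricmxZ.
by rewrite -scalemxAl mxdotZl mulr_ge0.
Qed.

End MatrixInnerProduct.

(** * Continuity, closedness and compactness in matrix spaces *)

Section MatrixTopology.
Variable R : realType.

Lemma continuous_sum (T : topologicalType) (V : normedModType R) (I : finType)
    (F : I -> T -> V) :
  (forall i, continuous (F i)) -> continuous (fun x => \sum_i F i x).
Proof.
move=> F_cont; by apply: continuous_big => //; exact: add_continuous.
Qed.

Lemma continuous_coord (T : topologicalType) p q (F : T -> 'M[R]_(p, q)) i j :
  continuous F -> continuous (fun x => F x i j).
Proof.
move=> F_cont x; apply: (@continuous_comp _ _ _ F (fun A => A i j)).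
  exact: F_cont.
exact: coord_continuous.
Qed.

Lemma mxdot_continuous (T : topologicalType) p q (F G : T -> 'M[R]_(p, q)) :
  continuous F -> continuous G -> continuous (fun x => mxdot (F x) (G x)).
Proof.
move=> F_cont G_cont; under eq_fun do rewrite mxdotE.
apply: continuous_sum => i; apply: continuous_sum => j x.
by apply: continuousM; exact: continuous_coord.
Qed.

(** Expanding in the basis of the [delta_mx i j] reduces the claim to finite sums of scalar
    functions times constant matrices. *)
Lemma mx_continuous (T : topologicalType) p q (F : T -> 'M[R]_(p, q)) :
  (forall i j, continuous (fun x => F x i j)) -> continuous F.
Proof.
move=> F_cont.
have -> : F = fun x => \sum_i \sum_j F x i j *: delta_mx i j.
  by apply/funext => x; exact: matrix_sum_delta.
apply: continuous_sum => i; apply: continuous_sum => j x.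
by apply: continuousZr_tmp; exact: F_cont.
Qed.

Lemma mulmx_continuous (T : topologicalType) p q r
    (F : T -> 'M[R]_(p, q)) (G : T -> 'M[R]_(q, r)) :
  continuous F -> continuous G -> continuous (fun x => F x *m G x).
Proof.
move=> F_cont G_cont; apply: mx_continuous => i j.
under eq_fun do rewrite mxE.
apply: continuous_sum => k x.
by apply: continuousM; exact: continuous_coord.
Qed.

Lemma vec_mx_continuous p q : continuous (@vec_mx R p q).
Proof.
apply: mx_continuous => i j; under eq_fun do rewrite mxE.
exact: coord_continuous.
Qed.

Lemma closed_preimage_continuous (T U : topologicalType) (F : T -> U)
    (D : set U) : continuous F -> closed D -> closed (F @^-1` D).
Proof. by move=> F_cont; apply: preimage_closed => x _; exact: F_cont. Qed.

Lemma compact_mxdot_ball p q (K : R) :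
  compact [set A : 'M[R]_(p, q) | mxdot A A <= K].
Proof.
(* The bound [K + 1] avoids a square root: if [t ^+ 2 <= K] then [t] has absolute value at most
   [K + 1]. The box lives in row vectors, where a product of segments is known to be compact, and
   [vec_mx] carries it to matrices. *)
pose box := [set v : 'rV[R]_(p * q) |
  forall j, v ord0 j \in `[- (K + 1), K + 1]].
have box_compact : compact box.
  by apply: (@rV_compact R _ (fun=> `[- (K + 1), K + 1]%classic)) => _;
    exact: segment_compact.
have image_compact : compact (vec_mx @` box : set 'M[R]_(p, q)).
  apply: continuous_compact box_compact.
  by apply: continuous_subspaceT; exact: vec_mx_continuous.
apply: subclosed_compact image_compact _.
  apply: (@closed_preimage_continuous _ _ (fun A : 'M[R]_(p, q) => mxdot A A)
    [set k | k <= K]); last exact: closed_le.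
  by apply: mxdot_continuous => ?; exact: cvg_id.
move=> A /= A_le; exists (mxvec A); last exact: mxvecK.
move=> j; rewrite in_itv /=; case/mxvec_indexP: j => i j; rewrite mxvecE.
have := sqr_coord_le_mxdot A i j; rewrite expr2 => ?.
by apply/andP; split; nra.
Qed.

(** Symmetry is the single inequality that the squared norm of [A^T - A] is at most 0, a closed
    condition on a continuous function. *)
Lemma closed_symmetricmx p : closed [set A : 'M[R]_p | A \is symmetricmx].
Proof.
have -> : [set A : 'M[R]_p | A \is symmetricmx] =
    (fun A : 'M[R]_p => mxdot (A^T - A) (A^T - A)) @^-1` [set r | r <= 0].
  apply/seteqP; split => A /=.
    by move=> /symmetricmxP A_sym; rewrite A_sym subrr mxdot0.
  by move=> /mxdot_le0/eqP; rewrite subr_eq0 => /eqP/symmetricmxP.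
apply: closed_preimage_continuous; last exact: closed_le.
have tr_sub : continuous (fun A : 'M[R]_p => A^T - A).
  apply: mx_continuous => i j; under eq_fun do rewrite !mxE.
  by move=> B; apply: continuousB; exact: coord_continuous.
exact: mxdot_continuous.
Qed.

(** For each fixed [v] the condition is a closed half-space in [A]; the cone is the intersection of
    these with the symmetric matrices. *)
Lemma closed_possemidefmx p : closed [set A : 'M[R]_p | possemidefmx A].
Proof.
have -> : [set A : 'M[R]_p | possemidefmx A] =
    [set A | A \is symmetricmx] `&` \bigcap_(v in [set: 'cV[R]_p])
      ((fun A : 'M[R]_p => mxdot (A *m v) v) @^-1` [set r | 0 <= r]).
  apply/seteqP; split => A [A_sym A_ge0]; split=> // v; last exact: A_ge0.
  by move=> _; exact: A_ge0.
apply: closedI; first exact: closed_symmetricmx.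
apply: closed_bigI => v _.
apply: closed_preimage_continuous; last exact: closed_ge.
apply: mxdot_continuous; last exact: cst_continuous.
by apply: mulmx_continuous => ?; [exact: cvg_id|exact: cst_continuous].
Qed.

End MatrixTopology.

(** * Coercive quadratic minimization over closed, midpoint-stable sets *)

Section Minimization.
Variable R : realType.

Lemma posdefmx_coercive n (M : 'M[R]_n) : posdefmx M ->
  exists2 c, 0 < c & forall v : 'cV[R]_n, c * mxdot v v <= mxdot (M *m v) v.
Proof.
move=> [_ M_gt0].
pose sphere := [set v : 'cV[R]_n | mxdot v v = 1].
have unit_vector (v : 'cV[R]_n) : v != 0 ->
    sphere ((Num.sqrt (mxdot v v))^-1 *: v) /\ 0 < mxdot v v.
  move=> v_neq0; have vv_gt0 : 0 < mxdot v v.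
    by rewrite ltNge; apply: contra v_neq0 => /mxdot_le0 ->.
  split=> //; rewrite /sphere /= mxdotZl mxdotZr mulrA -invfM -expr2.
  by rewrite sqr_sqrtr ?ltW // mulVf // gt_eqF.
(* The sphere is empty only when every vector is zero (dimension 0); any positive constant then
   works. *)
have [sphere0|/set0P sphere_neq0] := eqVneq sphere set0.
  exists 1 => // v; have [->|/unit_vector[]] := eqVneq v 0.
    by rewrite mulmx0 !mxdot0 mulr0.
  by rewrite sphere0.
have sphere_compact : compact sphere.
  apply: subclosed_compact (@compact_mxdot_ball R n 1 1) _ => [|v /= ->] //.
  apply: (@closed_preimage_continuous _ _ (fun v : 'cV[R]_n => mxdot v v)
    [set r | r = 1]); last exact: closed_eq.
  by apply: mxdot_continuous => ?; exact: cvg_id.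
have form_continuous : continuous (fun v : 'cV[R]_n => mxdot (M *m v) v).
  apply: mxdot_continuous => [|?]; last exact: cvg_id.
  by apply: mulmx_continuous => ?; [exact: cst_continuous|exact: cvg_id].
have [u u_sphere u_min] := compact_EVT_min sphere_neq0 sphere_compact
  (continuous_subspaceT form_continuous).
(* The minimum on the sphere is positive because [u] has norm 1 and so is nonzero; normalizing [v]
   extends the bound by homogeneity of degree two. *)
exists (mxdot (M *m u) u) => [|v].
  apply: M_gt0; apply: contraPneq (set_mem u_sphere) => ->.
  by rewrite /sphere /= mxdot0 => /esym/eqP; rewrite oner_eq0.
have [->|/unit_vector[v_sphere vv_gt0]] := eqVneq v 0.
  by rewrite mulmx0 !mxdot0 mulr0.
have := u_min _ (mem_set v_sphere); rewrite -scalemxAr mxdotZl mxdotZr mulrA.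
by rewrite -invfM -expr2 sqr_sqrtr ?(ltW vv_gt0) // ler_pdivlMl // mulrC.
Qed.

(** The constraint is abstracted to a set [F]: closedness serves existence, and stability under
    midpoints serves uniqueness. *)
Lemma quadratic_unique_minimizer n p q (c : 'cV[R]_n) (M : 'M[R]_n) (k : R)
    (F : set ('cV[R]_n * 'M[R]_(p, q))) :
  posdefmx M -> 0 < k -> F !=set0 -> closed F ->
  (forall a b, F a -> F b -> F (2^-1 *: (a + b))) ->
  exists! w, optimal_solution F
    (fun w => mxdot c w.1 + 2^-1 * mxdot (M *m w.1) w.1 + k / 2 * frob w.2 ^+ 2)
    w.
Proof.
move=> M_posdef k_gt0 [w0 Fw0] F_closed F_midpoint.
pose J (w : 'cV[R]_n * 'M[R]_(p, q)) : R :=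
  mxdot c w.1 + 2^-1 * mxdot (M *m w.1) w.1 + k / 2 * mxdot w.2 w.2.
have -> : (fun w : 'cV[R]_n * 'M[R]_(p, q) =>
    mxdot c w.1 + 2^-1 * mxdot (M *m w.1) w.1 + k / 2 * frob w.2 ^+ 2) = J.
  by apply/funext => w; rewrite frob_sqr.
have [e e_gt0 M_ge] := posdefmx_coercive M_posdef.
(* The term [e^-1 * mxdot c c] is the loss in [mxdot_AMGM] with weight [e]. Of the coercive [e / 2]
   in front of the squared norm, [e / 4] survives; both remaining squares are nonnegative, so [K]
   bounds each separately. *)
pose K := J w0 + e^-1 * mxdot c c.
have coercive w : J w <= J w0 ->
    mxdot w.1 w.1 <= 4 / e * K /\ mxdot w.2 w.2 <= 2 / k * K.
  move=> Jw; have lin_ge := mxdot_AMGM c w.1 e_gt0.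
  have quad_ge := M_ge w.1.
  have ww1 := mxdot_ge0 w.1; have ww2 := mxdot_ge0 w.2.
  have K_ge : e / 4 * mxdot w.1 w.1 + k / 2 * mxdot w.2 w.2 <= K.
    by move: Jw; rewrite {1}/J /K; lra.
  have t1 : 0 <= e / 4 * mxdot w.1 w.1 by rewrite mulr_ge0 // divr_ge0 // ltW.
  have t2 : 0 <= k / 2 * mxdot w.2 w.2 by rewrite mulr_ge0 // divr_ge0 // ltW.
  have d1 : e / 4 * mxdot w.1 w.1 <= K by lra.
  have d2 : k / 2 * mxdot w.2 w.2 <= K by lra.
  split.
    by rewrite -ler_pdivrMl ?divr_gt0 // invf_div.
  by rewrite -ler_pdivrMl ?divr_gt0 // invf_div.
(* By [coercive], this product of balls contains every point whose value is at most [J w0]. *)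
pose B := [set v : 'cV[R]_n | mxdot v v <= 4 / e * K] `*`
          [set A : 'M[R]_(p, q) | mxdot A A <= 2 / k * K].
have FB_compact : compact (F `&` B).
  rewrite setIC; apply: compact_closedI F_closed.
  by apply: compact_setX; exact: compact_mxdot_ball.
have J_continuous : continuous J.
  have fst_cont : continuous (fst : 'cV[R]_n * 'M[R]_(p, q) -> 'cV[R]_n).
    by move=> ?; exact: cvg_fst.
  have snd_cont : continuous (snd : 'cV[R]_n * 'M[R]_(p, q) -> 'M[R]_(p, q)).
    by move=> ?; exact: cvg_snd.
  have quad_cont : continuous (fun w : 'cV[R]_n * 'M[R]_(p, q) =>
      mxdot (M *m w.1) w.1).
    apply: mxdot_continuous => //; apply: mulmx_continuous => // ?.
    exact: cst_continuous.
  have sqr_cont : continuous (fun w : 'cV[R]_n * 'M[R]_(p, q) =>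
      mxdot w.2 w.2) by exact: mxdot_continuous.
  move=> w; rewrite /J; apply: cvgD; first apply: cvgD.
  - by apply: mxdot_continuous => // ?; exact: cst_continuous.
  - by apply: cvgM; [exact: cvg_cst|exact: quad_cont].
  - by apply: cvgM; [exact: cvg_cst|exact: sqr_cont].
have FB_neq0 : F `&` B !=set0 by exists w0; split=> //; exact: coercive.
have [w wFB w_min] := compact_EVT_min FB_neq0 FB_compact
  (continuous_subspaceT J_continuous).
have w_opt : optimal_solution F J w.
  split=> [|v Fv]; first by case/set_mem: wFB.
  have Jw : J w <= J w0.
    by apply: w_min; apply/mem_set; split=> //; exact: coercive.
  (* Minimality over [F] follows from minimality over the compact part: a feasible point either lies
     in [B] or has a value above [J w0], hence above [J w]. *)
  have [Jv|/ltW Jv] := leP (J v) (J w0); last exact: le_trans Jv.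
  by apply: w_min; apply/mem_set; split=> //; exact: coercive.
exists w; split=> // v [Fv v_min]; case: w_opt => Fw {}w_min.
have Jvw : J v = J w by apply/eqP; rewrite eq_le v_min // w_min.
have J_mid : J (2^-1 *: (w + v)) = 2^-1 * (J w + J v)
    - 8^-1 * mxdot (M *m (w.1 - v.1)) (w.1 - v.1)
    - k / 8 * mxdot (w.2 - v.2) (w.2 - v.2).
  (* Inserting an identity matrix lets [mxdot_midpoint] treat the Frobenius term as well; the linear
     term is exact at midpoints. *)
  rewrite /J /= -[X in mxdot X (2^-1 *: (w.2 + v.2))]mul1mx !mxdot_midpoint.
  by rewrite !mul1mx mxdotZr mxdotDr; field.
(* The midpoint cannot beat the minimum, so the two nonnegative deficits in [J_mid] vanish, and with
   them both differences. *)
have := w_min _ (F_midpoint _ _ Fw Fv); rewrite J_mid Jvw => mid_ge.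
have d1 := mxdot_ge0 (w.1 - v.1); have d2 := mxdot_ge0 (w.2 - v.2).
have quad_ge := M_ge (w.1 - v.1).
have t1 : 0 <= e * mxdot (w.1 - v.1) (w.1 - v.1) by rewrite mulr_ge0 // ltW.
have t2 : 0 <= k * mxdot (w.2 - v.2) (w.2 - v.2) by rewrite mulr_ge0 // ltW.
have s1 : e * mxdot (w.1 - v.1) (w.1 - v.1) <= 0 by lra.
have s2 : k * mxdot (w.2 - v.2) (w.2 - v.2) <= 0 by lra.
rewrite !pmulr_rle0 // in s1 s2.
move: s1 s2 => /mxdot_le0/eqP + /mxdot_le0/eqP; rewrite !subr_eq0.
by case: w v {wFB w_min v_min Fw Fv Jvw J_mid mid_ge d1 d2 quad_ge t1 t2}
  => [w1 w2] [v1 v2] /= /eqP -> /eqP ->.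
Qed.

End Minimization.

(** * The semidefinite constraint as an instance *)

Theorem proposition1 (R : realType) (n m d : nat)
  (f : 'cV[R]_n -> R) (g : 'cV[R]_n -> 'cV[R]_m) (X : 'cV[R]_n -> 'M[R]_d)
  (f_C2 : C2 f) (g_C2 : C2 g) (X_C2 : C2 X)
  (X_sym : forall z, X z \is symmetricmx)
  (x : 'cV[R]_n) (y : 'cV[R]_m) (Z : 'M[R]_d) (Z_sym : Z \is symmetricmx)
  (sigma : R) (sigma_gt0 : 0 < sigma) (H : 'M[R]_n) :
  let M := H + sigma^-1 *: (grads g x *m (grads g x)^T) in
  let s := y - sigma^-1 *: g x in
  let T := Z - sigma^-1 *: X x in
  posdefmx M ->
  exists! p : 'cV[R]_n * 'M[R]_d,
    optimal_solution
      [set q : 'cV[R]_n * 'M[R]_d | q.2 \is symmetricmx /\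
         possemidefmx (opA X x q.1 + sigma *: (q.2 - T))]
      (fun q : 'cV[R]_n * 'M[R]_d =>
         mxdot (grad f x - grads g x *m s) q.1
         + 2^-1 * mxdot (M *m q.1) q.1
         + sigma / 2 * frob q.2 ^+ 2)
      p.
Proof.
move=> M s T M_posdef.
have T_sym : T \is symmetricmx.
  by rewrite /T -scaleNr; apply: symmetricmxD => //; exact: symmetricmxZ.
apply: quadratic_unique_minimizer => //.
- exists (0, T); split=> //=.
  rewrite subrr scaler0 addr0 /opA big1 => [|i _]; first exact: possemidefmx0.
  by rewrite mxE scale0r.
- have fst_cont : continuous (fst : 'cV[R]_n * 'M[R]_d -> 'cV[R]_n).
    by move=> ?; exact: cvg_fst.
  have snd_cont : continuous (snd : 'cV[R]_n * 'M[R]_d -> 'M[R]_d).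
    by move=> ?; exact: cvg_snd.
  apply: closedI.
    exact: closed_preimage_continuous snd_cont (@closed_symmetricmx R d).
  apply: (@closed_preimage_continuous _ _ (fun q : 'cV[R]_n * 'M[R]_d =>
      opA X x q.1 + sigma *: (q.2 - T))); last exact: closed_possemidefmx.
  have opA_cont : continuous (fun q : 'cV[R]_n * 'M[R]_d => opA X x q.1).
    apply: continuous_sum => i q; apply: cvgZr_tmp.
    exact: continuous_coord.
  move=> q; apply: cvgD; first exact: opA_cont.
  by apply: cvgZl_tmp; apply: cvgB; [exact: snd_cont|exact: cvg_cst].
move=> a b [a_sym a_psd] [b_sym b_psd]; split.
  by apply: symmetricmxZ; exact: symmetricmxD.
(* The constraint map is affine, hence sends midpoints to midpoints, and the semidefinite cone is
   stable under sums and nonnegative scaling. *)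
have -> : opA X x (2^-1 *: (a + b)).1 + sigma *: ((2^-1 *: (a + b)).2 - T) =
    2^-1 *: ((opA X x a.1 + sigma *: (a.2 - T)) +
             (opA X x b.1 + sigma *: (b.2 - T))).
  have -> : opA X x (2^-1 *: (a + b)).1 = 2^-1 *: (opA X x a.1 + opA X x b.1).
    rewrite /opA -big_split scaler_sumr; apply: eq_bigr => i _ /=.
    by rewrite !mxE -scalerDl scalerA.
  apply/matrixP => i j; rewrite !mxE /=.
  by field; rewrite gt_eqF.
by apply: possemidefmxZ; [rewrite invr_ge0|exact: possemidefmxD].
Qed.
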